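(* Let $n>2$ and let $(M,g)$ be an $n$-dimensional closed connected Riemannian manifold with nonnegative Ricci curvature. Let $f\in C^{1}(0,\infty)\cap C[0,\infty)$ be a real-valued function having at least one zero in $[0,\infty)$. Let $u$ be a smooth positive solution of $$\Delta u+f(u)=0\quad\text{on } M.$$ Suppose that there is some $\beta\in\left(0,\frac{n+2}{n-2}\right)$ such that $$\beta f(s)-s f'(s)\ge 0\quad\text{for all } s>0.$$ Then $u$ is constant. The same conclusion ($u$ is constant) also holds if, instead of this last condition, the function $s\mapsto s^{-\frac{n+2}{n-2}}f(s)$ is strictly decreasing on $(0,\infty)$.
   Context: $\Delta$ denotes the Laplace–Beltrami operator of $(M,g)$, $\Delta u=g^{ij}u_{ij}$ (the trace of the Hessian). ''Closed'' means compact without boundary. The function $f$ is allowed to change sign. *)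

(* Defs.v *)
From HB Require Import structures.
From mathcomp Require Import all_boot all_order all_algebra.
From mathcomp Require Import all_classical all_reals all_analysis.

Set Implicit Arguments.
Unset Strict Implicit.
Unset Printing Implicit Defensive.

Import Order.TTheory GRing.Theory Num.Theory.
Import numFieldNormedType.Exports.

Local Open Scope classical_set_scope.
Local Open Scope ring_scope.

Section Euclidean.
Context {R : realType} {n : nat}.
Implicit Types (U : set 'rV[R]_n) (F : 'rV[R]_n -> R).

Definition pder (i : 'I_n) F : 'rV[R]_n -> R :=
  fun x => 'D_(delta_mx 0 i) F x.

(* U is meant to be open, so that F and its iterated partial derivatives at
   the points of U do not depend on the values of F outside U. *)
Fixpoint Ck_on (k : nat) U F : Prop :=
  (forall x, U x -> {for x, continuous F}) /\
  match k with
  | 0%N => True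
  | k'.+1 => forall i,
      (forall x, U x -> derivable F x (delta_mx 0 i)) /\ Ck_on k' U (pder i F)
  end.

Definition smooth_on U F : Prop := forall k, Ck_on k U F.

End Euclidean.

(* Tensor calculus in one coordinate system, G x being the matrix (g_ij(x)) of
   the metric. *)
Section LocalGeometry.
Context {R : realType} {n : nat}.
Variable G : 'rV[R]_n -> 'M[R]_n.

(* Gamma^k_ij, the connection coefficients of the Levi-Civita connection *)
Definition christoffel (k i j : 'I_n) (x : 'rV[R]_n) : R :=
  2^-1 * \sum_(l < n) invmx (G x) k l *
    (pder i (fun y => G y j l) x + pder j (fun y => G y i l) x
     - pder l (fun y => G y i j) x).

(* The component R^l_kij defined by
   nabla_i nabla_j d_k - nabla_j nabla_i d_k = sum_l R^l_kij d_l. *)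
Definition riemann (l k i j : 'I_n) (x : 'rV[R]_n) : R :=
  pder i (christoffel l j k) x - pder j (christoffel l i k) x
  + \sum_(p < n) (christoffel l i p x * christoffel p j k x
                  - christoffel l j p x * christoffel p i k x).

(* Ric(Y, Z) = tr (X |-> R(X, Y) Z), which is positive on round spheres *)
Definition ricci (x : 'rV[R]_n) : 'M[R]_n :=
  \matrix_(j, k) \sum_(i < n) riemann i k i j x.

Definition hessian (w : 'rV[R]_n -> R) (x : 'rV[R]_n) : 'M[R]_n :=
  \matrix_(i, j) (pder i (pder j w) x
                  - \sum_(k < n) christoffel k i j x * pder k w x).

Definition laplacian (w : 'rV[R]_n -> R) (x : 'rV[R]_n) : R :=
  \sum_(i < n) \sum_(j < n) invmx (G x) i j * hessian w x i j.

End LocalGeometry.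

(* A smooth atlas, not required to be maximal.  The coordinate map chart a and
   its inverse param a are total functions; they are only meaningful on
   dom a and on its image respectively. *)
Record smooth_atlas (R : realType) (n : nat) (M : topologicalType) := SmoothAtlas {
  idx : Type;
  dom : idx -> set M;
  chart : idx -> M -> 'rV[R]_n;
  param : idx -> 'rV[R]_n -> M;
  dom_cover : forall p, exists a, dom a p;
  dom_open : forall a, open (dom a);
  img_open : forall a, open (chart a @` dom a);
  chartK : forall a p, dom a p -> param a (chart a p) = p;
  chart_continuous : forall a p, dom a p -> {for p, continuous (chart a)};
  param_continuous : forall a x, (chart a @` dom a) x ->
    {for x, continuous (param a)};
  transition_smooth : forall a b (k : 'I_n),
    smooth_on (chart a @` (dom a `&` dom b))
              (fun x => chart b (param a x) 0 k)
}.

Section Manifold.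
Context {R : realType} {n : nat} {M : topologicalType}.
Variable A : smooth_atlas R n M.

Definition img (a : idx A) : set 'rV[R]_n := chart a @` dom a.

Definition smooth_fun (u : M -> R) : Prop :=
  forall a : idx A, smooth_on (img a) (u \o param a).

(* Entry (i, k) is the i-th partial derivative of the k-th component of the
   coordinate change from a to b. *)
Definition transition_jacobian (a b : idx A) (x : 'rV[R]_n) : 'M[R]_n :=
  \matrix_(i, k) pder i (fun y => chart b (param a y) 0 k) x.

(* A Riemannian metric, given by its components in every chart *)
Record riemannian_metric := RiemannianMetric {
  gmat : idx A -> 'rV[R]_n -> 'M[R]_n;
  gmat_smooth : forall a i j, smooth_on (img a) (fun x => gmat a x i j);
  gmat_sym : forall a x, img a x -> (gmat a x)^T = gmat a x;
  gmat_pos : forall a x (v : 'rV[R]_n), img a x -> v != 0 ->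
    0 < (v *m gmat a x *m v^T) 0 0;
  gmat_change : forall a b p, dom a p -> dom b p ->
    let J := transition_jacobian a b (chart a p) in
    gmat a (chart a p) = J *m gmat b (chart b p) *m J^T
}.

Variable g : riemannian_metric.

Definition nonneg_ricci : Prop :=
  forall (a : idx A) (x v : 'rV[R]_n), img a x ->
    0 <= (v *m ricci (gmat g a) x *m v^T) 0 0.

(* The value of the Laplace-Beltrami operator on u at p does not depend on the
   chart a around p used to compute it. *)
Definition laplace_beltrami_in (a : idx A) (u : M -> R) (p : M) : R :=
  laplacian (gmat g a) (u \o param a) (chart a p).

Definition solves (f : R -> R) (u : M -> R) : Prop :=
  forall (a : idx A) p, dom a p -> laplace_beltrami_in a u p + f (u p) = 0.

End Manifold.

(* Main.v *)
Require Import Defs.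
From HB Require Import structures.
From mathcomp Require Import all_boot all_order all_algebra.
From mathcomp Require Import all_classical all_reals all_analysis.
From mathcomp Require Import ring lra.
Import Order.TTheory GRing.Theory Num.Theory.
Import numFieldNormedType.Exports.
Local Open Scope classical_set_scope.
Local Open Scope ring_scope.

(* The maximum principle alone gives the result.  At a maximum point of u the
   Laplacian is nonpositive, so f (max u) >= 0; likewise f (min u) <= 0.  Either
   hypothesis makes s^(-b) f(s) nonincreasing for some exponent b.  If it is
   strictly decreasing, these two signs force min u = max u.  Otherwise they
   force f = 0 on [min u, max u], so u is harmonic on a closed connected
   manifold, hence constant by Hopf's strong maximum principle. *)

(** The sandwich behind the second case: with g(s) = s^(-b) f(s) nonincreasing, 0 <= g(max u) <= g(u
    q) <= g(min u) <= 0 at every point q, and g and f have the same sign. The equation then says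
    only that u is harmonic, and the sign of the Laplacian at a maximum gives no contradiction. It
    has to be made strict: where the set {u = max u} would have a boundary inside a chart, a small
    multiple of a function with positive Laplacian is added to u, and the sum still has an interior
    maximum on a small cube. All differential arguments are made in one chart with the coordinate
    formula for the Laplacian; compactness and connectedness enter only when passing to the whole
    manifold. *)

(** * Positive definite matrices and traces *)

Definition posdef {F : realFieldType} {n : nat} (A : 'M[F]_n) : Prop :=
  forall v : 'rV[F]_n, v != 0 -> 0 < (v *m A *m v^T) 0 0.

Lemma posdef_unitmx {F : realFieldType} {n : nat} (A : 'M[F]_n) :
  posdef A -> A \in unitmx.
Proof.
move=> Apos; rewrite -row_free_unit -kermx_eq0; apply: contraT => kerN0.
have /rowV0Pn[v /sub_kermxP vA v0] := kerN0.
by have := Apos v v0; rewrite vA mul0mx mxE ltxx.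
Qed.

Lemma posdef_invmx {F : realFieldType} {n : nat} (A : 'M[F]_n) :
  A^T = A -> posdef A -> posdef (invmx A).
Proof.
move=> Asym Apos v v0; have Au := posdef_unitmx A Apos.
have -> : v *m invmx A *m v^T = (v *m invmx A) *m A *m (v *m invmx A)^T.
  by rewrite trmx_mul trmx_inv Asym !mulmxA mulmxKV.
apply: Apos; apply: contra v0 => /eqP vA.
by rewrite -(mulmxKV Au v) vA mul0mx.
Qed.

Lemma mxtrace_mul_le0 {F : realFieldType} {n : nat} (A V : 'M[F]_n) :
  A^T = A -> posdef A -> (forall w : 'rV[F]_n, (w *m V *m w^T) 0 0 <= 0) ->
  \tr (A *m V) <= 0.
Proof.
(* Splitting off the Schur complement S of the first diagonal entry c gives
   A = c^-1 e^T e + S with e the first row of A. *)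
elim: n A V => [|n IHn]; first by move=> A V *; rewrite /mxtrace big_ord0.
rewrite -[n.+1]/(1 + n)%N => A V Asym Apos Vneg.
pose c := A 0 0.
pose b := @ursubmx _ 1 n 1 n A.
pose d := @drsubmx _ 1 n 1 n A.
pose p := @ulsubmx _ 1 n 1 n V; pose q := @ursubmx _ 1 n 1 n V.
pose r := @dlsubmx _ 1 n 1 n V; pose s := @drsubmx _ 1 n 1 n V.
have AE : A = block_mx c%:M b b^T d :> 'M[F]_(1 + n).
  rewrite -[LHS](@submxK _ 1 n 1 n); congr block_mx.
    by apply/matrixP => i j; rewrite !ord1 !mxE /c; congr (A _ _); apply/val_inj.
  by rewrite /b -{1}Asym -trmx_ursub.
have VE : V = block_mx p q r s :> 'M[F]_(1 + n) by rewrite submxK.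
have c0 : 0 < c.
  have := Apos (row_mx 1%:M 0 : 'rV[F]_(1 + n)); rewrite AE.
  rewrite tr_row_mx mul_row_block mul_row_col !mul1mx !mul0mx !addr0.
  rewrite trmx0 mulmx0 addr0 trmx1 mulmx1 !mxE eqxx; apply.
  apply/eqP => /(congr1 (fun M : 'rV[F]_(1 + n) => M 0 (lshift n 0))).
  by rewrite row_mxEl !mxE eqxx; apply/eqP/oner_neq0.
have cN0 : c != 0 by rewrite gt_eqF.
pose S := d - c^-1 *: (b^T *m b).
have dsym : d^T = d by rewrite /d trmx_drsub Asym.
have Ssym : S^T = S.
  by rewrite /S linearB linearZ /= trmx_mul trmxK dsym.
(* Completing the square: [t] is chosen so that the first entry of [row_mx t w *m A] vanishes, and
   the form of [A] at [row_mx t w] is then that of [S] at [w]. *)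
have Spos : posdef S.
  move=> w w0; pose t := - c^-1 *: (w *m b^T).
  have := Apos (row_mx t w : 'rV[F]_(1 + n)); rewrite AE.
  rewrite tr_row_mx mul_row_block mul_row_col.
  have -> : t *m c%:M + w *m b^T = 0.
    by rewrite mul_mx_scalar /t scalerA mulrN mulfV// scaleN1r addNr.
  rewrite mul0mx add0r /S mulmxBr mulmxBl.
  rewrite {1}/t mulmxDl addrC -!scalemxAl scaleNr -scalemxAr -scalemxAl !mulmxA.
  rewrite [(- c^-1) *: _ in X in X -> _]scaleNr; apply.
  apply: contra w0 => /eqP/(congr1 (@rsubmx _ 1 1 n)).
  by rewrite row_mxKr linear0 => /eqP.
have sneg (w : 'rV[F]_n) : (w *m s *m w^T) 0 0 <= 0.
  have := Vneg (row_mx 0 w : 'rV[F]_(1 + n)); rewrite VE.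
  by rewrite tr_row_mx mul_row_block mul_row_col !mul0mx !add0r trmx0 mulmx0 add0r.
have := IHn S s Ssym Spos sneg.
(* The rank-one part of [A] contributes to the trace c^-1 times the form of [V] at the first row of
   [A]. *)
have := Vneg (row_mx c%:M b : 'rV[F]_(1 + n)).
rewrite -(ler_pM2l (x := c^-1)) ?invr_gt0// mulr0.
rewrite {1}VE tr_row_mx mul_row_block mul_row_col tr_scalar_mx.
set e := _ + _ => e0 Ss0.
have -> : \tr (A *m V) = \tr (S *m s) + c^-1 * e 0 0.
  have -> : e 0 0 = \tr e by rewrite /mxtrace big_ord1.
  rewrite {1}AE VE (mulmx_block c%:M) (mxtrace_block (n1 := 1)).
  rewrite /S mulmxBl linearB /= -scalemxAl mxtraceZ.
  rewrite /e !mulmxDl !mul_mx_scalar !mul_scalar_mx !mxtraceD -scalemxAl !mxtraceZ.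
  rewrite (mxtrace_mulC b^T q) -(mulmxA b^T b s) (mxtrace_mulC b^T (b *m s)).
  by field.
by rewrite -[leRHS]addr0 lerD.
Qed.

(** * Calculus along lines *)

Lemma is_derive_line {R : realType} {V : normedModType R} (F : V -> R)
  (x v : V) (t l : R) :
  is_derive (x + t *: v) v F l -> is_derive t 1 (fun s => F (x + s *: v)) l.
Proof.
have E : (fun h : R => h^-1 *: ((F \o shift (x + t *: v)) (h *: v) - F (x + t *: v)))
  = (fun h : R => h^-1 *: (((fun s => F (x + s *: v)) \o shift t) (h *: 1)
       - F (x + t *: v))).
  apply/funext => h /=; congr (_ *: (F _ - _)).
  by rewrite scalerDl addrCA [h *: 1]mulr1.
by move=> [dF eF]; split; [move: dF|move: eF]; rewrite /derivable /derive E.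
Qed.

(** A mean value theorem for increments of either sign, as needed for the increment [h * c] in
    [is_deriveDdir]. *)
Lemma MVT0 {R : realType} (phi dphi : R -> R) (s : R) :
  (forall t : R, `|t| <= `|s| -> is_derive t 1 phi (dphi t)) ->
  exists2 th, `|th| <= `|s| & phi s - phi 0 = s * dphi th.
Proof.
move=> dphiP.
have cphi (a b : R) : (forall t, t \in `[a, b]%R -> `|t| <= `|s|) ->
    {within `[a, b], continuous phi}.
  move=> ab; apply: derivable_within_continuous => t /ab /dphiP ?.
  exact: ex_derive.
have [s0|s0] := leP 0 s.
  have sub t : t \in `[0, s]%R -> `|t| <= `|s|.
    by rewrite in_itv/= => /andP[t0 ts]; rewrite !ger0_norm.
  have [|th /sub ths ->] := @MVT_segment R phi dphi 0 s s0 _ (cphi _ _ sub).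
    by move=> t /subset_itv_oo_cc/sub/dphiP.
  by exists th => //; rewrite subr0 mulrC.
have sub t : t \in `[s, 0]%R -> `|t| <= `|s|.
  by rewrite in_itv/= => /andP[t0 ts]; rewrite !ler0_norm ?lerN2// ltW.
have [|th /sub ths e] := @MVT_segment R phi dphi s 0 (ltW s0) _ (cphi _ _ sub).
  by move=> t /subset_itv_oo_cc/sub/dphiP.
by exists th => //; rewrite -opprB e sub0r mulrN opprK mulrC.
Qed.

Lemma second_derivative_test {R : realType} (phi psi : R -> R) (q : R) :
  (\forall t \near (0 : R), is_derive (t : R) 1 phi (psi t)) ->
  is_derive (0 : R) 1 psi q ->
  (\forall t \near 0, phi t <= phi 0) -> psi 0 = 0 /\ q <= 0.
Proof.
move=> dphi dpsi phimax.
have /nbhs_ballP[r /= r0 rP] : \forall t \near (0 : R),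
    is_derive (t : R) 1 phi (psi t) /\ phi t <= phi 0.
  by near=> t; split; near: t.
have {}rP t : `|t| < r -> is_derive (t : R) 1 phi (psi t) /\ phi t <= phi 0.
  by move=> tr; apply: rP; rewrite /ball/= sub0r normrN.
have psi0 : psi 0 = 0.
  have r0' : 0 \in `]- r, r[%R by rewrite in_itv/= oppr_lt0 r0.
  have rr : - r <= r by rewrite (@le_trans _ _ 0)// ?oppr_le0 ltW.
  have drv t : t \in `]- r, r[%R -> derivable phi t 1.
    by rewrite in_itv/= -ltr_norml => /rP[? _]; exact: ex_derive.
  have mx t : t \in `]- r, r[%R -> phi t <= phi 0.
    by rewrite in_itv/= -ltr_norml => /rP[].
  have [_ dE] := derive1_at_max rr drv r0' mx.
  have [|[_ dp] _] := rP 0; first by rewrite normr0.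
  by rewrite -dp dE.
split => //; rewrite leNgt; apply/negP => q0.
(* If [q] were positive, the quotient [psi h / h], within [q] of its limit [q], would be positive.
   So [psi] would be positive just to the right of 0, and the mean value theorem would give
   [phi t > phi 0]. *)
have [/= /cvgrPdist_lt/(_ q q0) psiq qE] := dpsi.
have {psiq} /nbhs_ballP[e /= e0 eP] : \forall h \near (0 : R), 0 < h -> 0 < psi h.
  move: psiq; rewrite -/(derive psi 0 1) qE nearE /= -nearE near_withinE.
  apply: filterS => h; rewrite psi0 subr0 addr0 [h *: 1]mulr1 => + h0.
  rewrite gt_eqF// => /(_ isT); rewrite ltr_norml => /andP[_].
  by rewrite ltrBlDl addrC -ltrBlDl subrr pmulr_rgt0 ?invr_gt0.
pose t := Num.min r e / 2.
have m0 : 0 < Num.min r e by rewrite lt_min r0 e0.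
have t0 : 0 < t by rewrite divr_gt0.
have tm : t < Num.min r e by rewrite /t; lra.
have /andP[tr te] : (t < r) && (t < e) by rewrite -lt_min.
have rP' x : x \in `[0, t]%R -> `|x| < r.
  by rewrite in_itv/= => /andP[x0 xt]; rewrite ger0_norm// (le_lt_trans xt).
have [x||x] := @MVT R phi psi 0 t t0.
- by move=> /subset_itv_oo_cc/rP'/rP[].
- apply: derivable_within_continuous => x /rP'/rP[? _]; exact: ex_derive.
rewrite in_itv/= subr0 => /andP[x0 xt] /eqP; rewrite subr_eq => /eqP E.
have : phi t <= phi 0 by apply: (rP _ _).2; rewrite gtr0_norm.
rewrite E gerDr leNgt mulr_gt0//.
by apply: eP => //=; rewrite /ball/= sub0r normrN gtr0_norm// (lt_trans xt).
Unshelve. all: by end_near. Qed.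

(** The step by which continuous partial derivatives yield all directional ones: move by [h *: v]
    first, then by [(h * c) *: w]. The mean value theorem turns the second increment into [h * c]
    times a value of [dF] near [x], and continuity of [dF] gives the limit. *)
Lemma is_deriveDdir {R : realType} {V : normedModType R} (F dF : V -> R)
  (x v w : V) (l c : R) :
  is_derive x v F l -> (\forall y \near x, is_derive y w F (dF y)) ->
  {for x, continuous dF} -> is_derive x (v + c *: w) F (l + c * dF x).
Proof.
move=> [dF1 l1] dF2 cdF.
suff cv : (fun h : R => h^-1 *: ((F \o shift x) (h *: (v + c *: w)) - F x)) @ 0^'
    --> l + c * dF x.
  by split; [apply/cvg_ex; exists (l + c * dF x)|apply: cvg_lim].
have cv1 : (fun h : R => h^-1 *: ((F \o shift x) (h *: v) - F x)) @ 0^' --> l.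
  by rewrite -l1.
have cv2 : (fun h : R => h^-1 *: (F (x + h *: v + (h * c) *: w) - F (x + h *: v)))
    @ 0^' --> c * dF x.
  apply/cvgrPdist_le => e e0.
  (* The [+ 1] keeps the divisor of [e] nonzero when [c] is 0. *)
  have c1 : 0 < `|c| + 1 by rewrite ltr_wpDl.
  have e1 : 0 < e / (`|c| + 1) by rewrite divr_gt0.
  have /nbhs_ballP[r /= r0 rP] : \forall y \near x,
      is_derive y w F (dF y) /\ `|dF x - dF y| <= e / (`|c| + 1).
    by near=> y; split; near: y => //; move/cvgrPdist_le : cdF; apply.
  have nr : \forall h \near (0 : R)^', `|h| * (`|v| + `|c| * `|w|) < r.
    have cv : (fun h : R => `|h| * (`|v| + `|c| * `|w|)) @ 0 -->
        `|0 : R| * (`|v| + `|c| * `|w|).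
      by apply: cvgM; [apply: cvg_norm; exact: cvg_id|exact: cvg_cst].
    by apply: cvg_within; move/cvgr_lt : cv; apply; rewrite normr0 mul0r.
  near=> h.
  have hN0 : h != 0 by near: h; exact: nbhs_dnbhs_neq.
  have hr : `|h| * (`|v| + `|c| * `|w|) < r by near: h.
  have inb t : `|t| <= `|h * c| -> ball x r (x + h *: v + t *: w).
    move=> th; rewrite -ball_normE /ball_/= -addrA opprD addrA subrr sub0r.
    rewrite normrN (le_lt_trans (ler_normD _ _))// (le_lt_trans _ hr)//.
    by rewrite !normrZ mulrDr lerD2l mulrA -normrM ler_wpM2r.
  have [|th thh E] := @MVT0 R (fun t => F (x + h *: v + t *: w))
      (fun t => dF (x + h *: v + t *: w)) (h * c).
    by move=> t /inb/rP[? _]; exact: is_derive_line.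
  have -> : F (x + h *: v + (h * c) *: w) - F (x + h *: v) =
      h * c * dF (x + h *: v + th *: w) by rewrite -E scale0r addr0.
  rewrite [_ *: _]mulrA mulrA mulVf// mul1r -mulrBr normrM.
  have /inb/rP[_ xy] := thh.
  rewrite (le_trans (ler_wpM2l _ xy))// mulrCA ler_piMr//.
    exact: ltW.
  by rewrite ler_pdivrMr// mul1r lerDl.
have -> : (fun h : R => h^-1 *: ((F \o shift x) (h *: (v + c *: w)) - F x)) =
  (fun h : R => h^-1 *: ((F \o shift x) (h *: v) - F x)) \+
  (fun h : R => h^-1 *: (F (x + h *: v + (h * c) *: w) - F (x + h *: v))).
  apply/funext => h /=; rewrite -scalerDr; congr (_ *: _).
  rewrite [RHS]addrC (addrC (h *: v)) addrA subrK.
  by congr (F _ - _); rewrite scalerDr scalerA addrC addrA.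
exact: cvgD.
Unshelve. all: by end_near. Qed.

(** * Functions of class C^k on an open set of coordinates *)

Section Euclid.
Context {R : realType} {n : nat}.
Implicit Types (U : set 'rV[R]_n) (F H : 'rV[R]_n -> R).

Lemma Ck_on_is_derive k U F x i :
  Ck_on k.+1 U F -> U x -> is_derive x (delta_mx 0 i) F (pder i F x).
Proof. by move=> [_ /(_ i)[dF _]] /dF/derivableP. Qed.

Lemma Ck_on_pder k U F i : Ck_on k.+1 U F -> Ck_on k U (pder i F).
Proof. by move=> [_ /(_ i)[]]. Qed.

Lemma Ck_on_cont k U F x : Ck_on k U F -> U x -> {for x, continuous F}.
Proof. by case: k => [|k] [cF _]; exact: cF. Qed.

(** The coordinates of [w] are added one at a time by [is_deriveDdir]. *)
Lemma Ck_on_is_derive_dir k U F x w : open U -> Ck_on k.+1 U F -> U x ->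
  is_derive x w F (\sum_i w 0 i * pder i F x).
Proof.
move=> oU CF Ux; rewrite [w in is_derive x w](matrix_sum_delta w) big_ord1.
elim: (index_enum _) => [|i s IHs]; first by rewrite !big_nil; exact: is_derive0.
rewrite !big_cons addrC [X in is_derive _ _ _ X]addrC.
apply: is_deriveDdir => //; last first.
  exact: Ck_on_cont (Ck_on_pder _ _ _ i CF) Ux.
have : \forall y \near x, U y by exact: open_nbhs_nbhs.
by apply: filterS => y; exact: Ck_on_is_derive CF.
Qed.

Lemma near_open_eq U F H x : open U -> U x -> (forall y, U y -> F y = H y) ->
  \forall y \near x, F y = H y.
Proof.
move=> oU Ux FH; have : \forall y \near x, U y by exact: open_nbhs_nbhs.
by apply: filterS => y /FH.
Qed.

Lemma Ck_on_ext k U F H : open U -> (forall y, U y -> F y = H y) ->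
  Ck_on k U F -> Ck_on k U H.
Proof.
move=> oU; elim: k F H => [|k IHk] F H FH [cF dF].
all: have cH : forall x, U x -> {for x, continuous H}.
1, 3: move=> x Ux; have FHx := near_open_eq U F H x oU Ux FH.
1, 2: rewrite /prop_for /continuous_at -(FH x Ux).
1, 2: by apply: cvg_trans (cF x Ux); apply: (near_eq_cvg FHx).
  by [].
split=> // i; have [dFi CF] := dF i; split.
  by move=> x Ux; apply: near_eq_derivable (dFi x Ux); exact: near_open_eq FH.
apply: IHk CF => y Uy; apply: near_eq_derive; exact: near_open_eq FH.
Qed.

Lemma pder_lin (c d : R) F H i x :
  derivable F x (delta_mx 0 i) -> derivable H x (delta_mx 0 i) ->
  is_derive x (delta_mx 0 i) (fun y => c * F y + d * H y)
    (c * pder i F x + d * pder i H x).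
Proof.
move=> /derivableP dF /derivableP dH.
exact: (is_deriveD (is_deriveZ c dF) (is_deriveZ d dH)).
Qed.

Lemma Ck_on_lin k U (c d : R) F H : open U -> Ck_on k U F -> Ck_on k U H ->
  Ck_on k U (fun y => c * F y + d * H y).
Proof.
move=> oU; elim: k F H => [|k IHk] F H [cF dF] [cH dH].
all: split.
1, 3: move=> x Ux.
1, 2: exact: (cvgD (cvgM (cvg_cst c) (cF x Ux)) (cvgM (cvg_cst d) (cH x Ux))).
  by [].
move=> i; have [dFi CF] := dF i; have [dHi CH] := dH i; split.
  by move=> x Ux; have [] := pder_lin c d F H i x (dFi x Ux) (dHi x Ux).
apply: (Ck_on_ext _ _ (fun y => c * pder i F y + d * pder i H y)) => //.
  move=> y Uy; apply/esym.
  by have [] := pder_lin c d F H i y (dFi y Uy) (dHi y Uy).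
exact: IHk.
Qed.

(** Both claims come from [second_derivative_test] on the lines [z + t *: w]; coordinate vectors [w]
    give the vanishing gradient. *)
Lemma second_order_max U (v : 'rV[R]_n -> R) z : open U -> Ck_on 2 U v -> U z ->
  (\forall y \near z, v y <= v z) ->
  (forall i, pder i v z = 0) /\
  forall w : 'rV[R]_n, \sum_i \sum_j w 0 i * w 0 j * pder i (pder j v) z <= 0.
Proof.
move=> oU Cv Uz vmax.
have main (w : 'rV[R]_n) : \sum_i w 0 i * pder i v z = 0 /\
    \sum_i \sum_j w 0 i * w 0 j * pder i (pder j v) z <= 0.
  have cl : (fun t : R => z + t *: w) @ 0 --> z.
    rewrite -[X in _ --> X]addr0 -(scale0r w).
    by apply: cvgD; [exact: cvg_cst|apply: cvgZr_tmp].
  have [] := @second_derivative_test R (fun t => v (z + t *: w))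
    (fun t => \sum_i w 0 i * pder i v (z + t *: w))
    (\sum_i \sum_j w 0 i * w 0 j * pder i (pder j v) z).
  - have : \forall t \near (0 : R), U (z + t *: w).
      exact/cl/open_nbhs_nbhs.
    apply: filterS => t Ut; apply: is_derive_line.
    exact: Ck_on_is_derive_dir oU Cv Ut.
  - have -> : (fun t : R => \sum_j w 0 j * pder j v (z + t *: w)) =
        \sum_j w 0 j *: (fun t : R => pder j v (z + t *: w)).
      by apply/funext => t; rewrite fct_sumE.
    rewrite exchange_big /=; apply: is_derive_eq.
      apply: is_derive_sum => j; apply: is_deriveZ; apply: is_derive_line.
      rewrite scale0r addr0.
      exact: Ck_on_is_derive_dir oU (Ck_on_pder _ _ _ j Cv) Uz.
    apply: eq_bigr => j _; rewrite [_ *: _]mulr_sumr; apply: eq_bigr => i _.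
    by rewrite mulrA [w 0 j * _]mulrC.
  - move: vmax => /cl; rewrite scale0r addr0; exact.
  by rewrite scale0r addr0.
split=> [i|w]; last exact: (main w).2.
have [+ _] := main (delta_mx 0 i).
rewrite (bigD1 i)//= big1 => [|j ji]; last by rewrite mxE eqxx (negPf ji) mul0r.
by rewrite mxE !eqxx mul1r addr0.
Qed.

End Euclid.

(** * Limits of determinants and inverse matrices *)

Lemma cvg_sumR {R : realType} {T I : Type} (F : set_system T) {FF : Filter F}
  (r : seq I) (f : I -> T -> R) (l : I -> R) :
  (forall i, f i x @[x --> F] --> l i) ->
  (\sum_(i <- r) f i x) @[x --> F] --> \sum_(i <- r) l i.
Proof.
by move=> fl; apply: (@cvg_big _ _ _ _ xpredT add_continuous) => // i _; exact: fl.
Qed.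

Lemma cvg_prodR {R : realType} {T I : Type} (F : set_system T) {FF : Filter F}
  (r : seq I) (f : I -> T -> R) (l : I -> R) :
  (forall i, f i x @[x --> F] --> l i) ->
  (\prod_(i <- r) f i x) @[x --> F] --> \prod_(i <- r) l i.
Proof.
by move=> fl; apply: (@cvg_big _ _ _ _ xpredT mul_continuous) => // i _; exact: fl.
Qed.

Lemma cvg_det {R : realType} {T : Type} (F : set_system T) {FF : Filter F}
  (n : nat) (G : T -> 'M[R]_n) (L : 'M[R]_n) :
  (forall i j, G x i j @[x --> F] --> L i j) ->
  \det (G x) @[x --> F] --> \det L.
Proof.
move=> GL; apply: cvg_sumR => s; apply: cvgM; first exact: cvg_cst.
by apply: cvg_prodR => i; exact: GL.
Qed.

(** By the cofactor formula. Since [invmx] returns a singular matrix unchanged, the formula is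
    available only where [G x] is invertible, hence the first hypothesis. *)
Lemma cvg_invmx {R : realType} {T : Type} (F : set_system T) {FF : Filter F}
  (n : nat) (G : T -> 'M[R]_n) (L : 'M[R]_n) :
  (\forall x \near F, G x \in unitmx) -> L \in unitmx ->
  (forall i j, G x i j @[x --> F] --> L i j) ->
  forall i j, invmx (G x) i j @[x --> F] --> invmx L i j.
Proof.
move=> Gu Lu GL i j; rewrite /invmx Lu mxE.
have Gdet : \det (G x) @[x --> F] --> \det L by exact: cvg_det.
have Gcof : cofactor (G x) j i @[x --> F] --> cofactor L j i.
  apply: cvgM; first exact: cvg_cst.
  by apply: cvg_det => k l; under eq_cvg do rewrite !mxE; rewrite !mxE; exact: GL.
have : (\det (G x))^-1 * cofactor (G x) j i @[x --> F] -->
    (\det L)^-1 * cofactor L j i.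
  by apply: cvgM => //; apply: cvgV => //; rewrite -unitfE -unitmxE.
rewrite mxE; apply: cvg_trans; apply: near_eq_cvg.
by apply: filterS Gu => x Gx; rewrite Gx !mxE.
Qed.

(** * The Laplacian in one chart *)

Section Laplacian.
Context {R : realType} {n : nat}.
Variables (G : 'rV[R]_n -> 'M[R]_n) (U : set 'rV[R]_n).
Hypothesis oU : open U.

Lemma laplacian_le0_max (v : 'rV[R]_n -> R) z :
  (G z)^T = G z -> posdef (G z) -> Ck_on 2 U v -> U z ->
  (\forall y \near z, v y <= v z) -> laplacian G v z <= 0.
Proof.
move=> Gsym Gpos Cv Uz vmax.
have [v1 v2] := second_order_max U v z oU Cv Uz vmax.
(* The gradient vanishes at a maximum, which removes the Christoffel terms. The indices of the
   second derivatives are swapped to fit the trace of a product. *)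
have -> : laplacian G v z =
    \tr (invmx (G z) *m (\matrix_(i, j) pder j (pder i v) z)).
  rewrite /mxtrace; apply: eq_bigr => i _; rewrite mxE; apply: eq_bigr => j _.
  by rewrite !mxE big1 ?subr0// => k _; rewrite v1 mulr0.
apply: mxtrace_mul_le0.
- by rewrite trmx_inv Gsym.
- exact: posdef_invmx.
move=> w; rewrite (le_trans _ (v2 w))// le_eqVlt; apply/orP; left; apply/eqP.
rewrite mxE; apply: eq_bigr => i _; rewrite !mxE mulr_suml.
by apply: eq_bigr => j _; rewrite mxE; ring.
Qed.

Lemma laplacian_lin (c d : R) (F H : 'rV[R]_n -> R) x :
  Ck_on 2 U F -> Ck_on 2 U H -> U x ->
  laplacian G (fun y => c * F y + d * H y) x =
    c * laplacian G F x + d * laplacian G H x.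
Proof.
move=> CF CH Ux.
have p1 k y : U y -> pder k (fun z => c * F z + d * H z) y =
    c * pder k F y + d * pder k H y.
  move=> Uy.
  by have [] := pder_lin c d F H k y ((CF.2 k).1 y Uy) ((CH.2 k).1 y Uy).
have p2 i k : pder i (pder k (fun z => c * F z + d * H z)) x =
    c * pder i (pder k F) x + d * pder i (pder k H) x.
  have [_] := pder_lin c d _ _ i x (((CF.2 k).2.2 i).1 x Ux)
    (((CH.2 k).2.2 i).1 x Ux).
  move=> <-; apply: near_eq_derive; exact: near_open_eq (p1 k).
rewrite /laplacian !mulr_sumr -big_split; apply: eq_bigr => i _ /=.
rewrite !mulr_sumr -big_split; apply: eq_bigr => j _ /=.
rewrite !mxE p2.
have -> : \sum_k christoffel G k i j x * pder k (fun z => c * F z + d * H z) x =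
  c * (\sum_k christoffel G k i j x * pder k F x) +
  d * (\sum_k christoffel G k i j x * pder k H x).
  rewrite !mulr_sumr -big_split; apply: eq_bigr => k _ /=.
  by rewrite p1//; ring.
move: (\sum_k christoffel G k i j x * pder k F x)
  (\sum_k christoffel G k i j x * pder k H x) (invmx (G x) i j)
  (pder i (pder j F) x) (pder i (pder j H) x) => *; ring.
Qed.

Hypothesis CG : forall i j, Ck_on 1 U (fun x => G x i j).
Hypothesis Gunit : forall x, U x -> G x \in unitmx.

Lemma invmx_cvg x i j : U x -> invmx (G y) i j @[y --> x] --> invmx (G x) i j.
Proof.
move=> Ux; have : \forall y \near x, G y \in unitmx.
  have : \forall y \near x, U y by exact: open_nbhs_nbhs.
  by apply: filterS.
move/cvg_invmx; apply; first exact: Gunit.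
by move=> k l; exact: Ck_on_cont (CG k l) Ux.
Qed.

Lemma christoffel_cvg x k i j : U x ->
  christoffel G k i j y @[y --> x] --> christoffel G k i j x.
Proof.
move=> Ux.
have pc m p q : pder m (fun y => G y p q) y @[y --> x] --> pder m (fun y => G y p q) x.
  exact: Ck_on_cont (Ck_on_pder _ _ _ m (CG p q)) Ux.
have ic p q := invmx_cvg x p q Ux.
rewrite /christoffel; move: (nbhs x) (nbhs_filter x) pc ic => F FF pc ic.
apply: cvgM; first exact: cvg_cst.
apply: cvg_sumR => l; apply: cvgM; first exact: ic.
by apply: cvgB; [apply: cvgD|]; exact: pc.
Qed.

(** Its purpose is to spread the positivity of the barrier's Laplacian from one point to a
    neighborhood. *)
Lemma laplacian_cvg (v : 'rV[R]_n -> R) x : Ck_on 2 U v -> U x ->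
  laplacian G v y @[y --> x] --> laplacian G v x.
Proof.
move=> Cv Ux.
have pc k : pder k v y @[y --> x] --> pder k v x.
  exact: Ck_on_cont (Ck_on_pder _ _ _ k Cv) Ux.
have ppc i j : pder i (pder j v) y @[y --> x] --> pder i (pder j v) x.
  exact: Ck_on_cont (Ck_on_pder _ _ _ i (Ck_on_pder _ _ _ j Cv)) Ux.
have ic i j := invmx_cvg x i j Ux; have cc k i j := christoffel_cvg x k i j Ux.
rewrite /laplacian.
move: (nbhs x) (nbhs_filter x) pc ppc ic cc => F FF pc ppc ic cc.
apply: cvg_sumR => i; apply: cvg_sumR => j; apply: cvgM; first exact: ic.
under eq_cvg do rewrite mxE; rewrite mxE; apply: cvgB; first exact: ppc.
by apply: cvg_sumR => k; apply: cvgM; [exact: cc|exact: pc].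
Qed.

End Laplacian.

(** * The quadratic barrier and its derivatives *)

Section Barrier.
Context {R : realType} {n : nat}.
Implicit Types (a nu x v : 'rV[R]_n) (K : R).

Definition dotp (nu x : 'rV[R]_n) : R := \sum_i nu 0 i * x 0 i.
(** The norm on row vectors is the sup norm, whose balls are cubes; the touching ball of Hopf's
    argument must be round. *)
Definition sqdist (x a : 'rV[R]_n) : R := \sum_i (x 0 i - a 0 i) ^+ 2.
(* Quadratic substitute for Hopf's exponential barrier: near a, the set where it
   is nonnegative lies, up to the point a, inside the open ball of center a + nu
   through a, and it is strictly subharmonic at a when K is large. *)
Definition barrier (K : R) (a nu x : 'rV[R]_n) : R :=
  dotp nu (x - a) + K * (dotp nu (x - a)) ^+ 2 - sqdist x a.

Lemma is_derive_coord x v a i :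
  is_derive x v (fun y : 'rV[R]_n => y 0 i - a 0 i) (v 0 i).
Proof.
have E : \forall h \near (0 : R)^', h^-1 *:
    (((fun y : 'rV[R]_n => y 0 i - a 0 i) \o shift x) (h *: v) - (x 0 i - a 0 i))
    = v 0 i.
  near=> h; have h0 : h != 0 by near: h; exact: nbhs_dnbhs_neq.
  rewrite /= !mxE (_ : _ - (_ - _) = h * v 0 i); last by ring.
  by rewrite [_ *: _]mulrA mulVf// mul1r.
split; first by apply: is_cvg_near_cst; exact: E.
by apply: norm_lim_near_cst; exact: E.
Unshelve. all: by end_near. Qed.

Lemma is_derive_sumr (f df : 'I_n -> 'rV[R]_n -> R) x v :
  (forall i, is_derive x v (f i) (df i x)) ->
  is_derive x v (fun y => \sum_i f i y) (\sum_i df i x).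
Proof.
move=> fP; have -> : (fun y => \sum_i f i y) = \sum_i f i.
  by apply/funext => y; rewrite fct_sumE.
exact: is_derive_sum.
Qed.

Lemma is_derive_dotp nu a x v :
  is_derive x v (fun y => dotp nu (y - a)) (dotp nu v).
Proof.
rewrite /dotp; under [X in is_derive _ _ X]funext => y do
  under eq_bigr do rewrite !mxE.
apply: (is_derive_sumr _ (fun i _ => nu 0 i * v 0 i)) => i.
exact: (is_deriveZ _ (is_derive_coord x v a i)).
Qed.

Lemma is_derive_barrier K a nu x v :
  is_derive x v (barrier K a nu)
    (dotp nu v + 2 * K * dotp nu (x - a) * dotp nu v
     - 2 * \sum_i (x 0 i - a 0 i) * v 0 i).
Proof.
have ds := is_derive_dotp nu a x v.
have dq : is_derive x v (sqdist^~ a) (\sum_i 2 * ((x 0 i - a 0 i) * v 0 i)).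
  apply: (is_derive_sumr _ (fun i x => 2 * ((x 0 i - a 0 i) * v 0 i))) => i.
  have dc := is_derive_coord x v a i.
  rewrite (_ : (fun y : 'rV[R]_n => _) =
    (fun y => y 0 i - a 0 i) * (fun y => y 0 i - a 0 i)); last first.
    by apply/funext => y; rewrite expr2.
  apply: (is_derive_eq (is_deriveM dc dc)).
  by rewrite /GRing.scale /=; ring.
have -> : barrier K a nu = (fun y => dotp nu (y - a)) +
    K *: ((fun y => dotp nu (y - a)) * (fun y => dotp nu (y - a))) - sqdist^~ a.
  by apply/funext => y; rewrite /barrier expr2.
apply: (is_derive_eq
  (is_deriveB (is_deriveD ds (is_deriveZ K (is_deriveM ds ds))) dq)).
by rewrite -mulr_sumr /GRing.scale /=; ring.
Qed.

Lemma pder_barrier K a nu i x : pder i (barrier K a nu) x =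
  nu 0 i + 2 * K * nu 0 i * dotp nu (x - a) - 2 * (x 0 i - a 0 i).
Proof.
have dotd (u : 'rV[R]_n) : \sum_j u 0 j * (delta_mx 0 i : 'rV[R]_n) 0 j = u 0 i.
  rewrite (bigD1 i)//= big1 => [|j ji]; last by rewrite mxE eqxx (negPf ji) mulr0.
  by rewrite mxE !eqxx mulr1 addr0.
have [_] := is_derive_barrier K a nu x (delta_mx 0 i); rewrite -/(pder _ _ _) => ->.
rewrite /dotp dotd.
have := dotd (x - a); rewrite mxE mxE => <-.
congr (_ + _ - 2 * _); first by ring.
by apply: eq_bigr => j _; rewrite !mxE.
Qed.

Lemma pder2_barrier K a nu i j x : is_derive x (delta_mx 0 j)
  (pder i (barrier K a nu)) (2 * K * nu 0 i * nu 0 j - 2 * (i == j)%:R).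
Proof.
have -> : pder i (barrier K a nu) = cst (nu 0 i) +
    (2 * K * nu 0 i) *: (fun y => dotp nu (y - a)) -
    2 *: (fun y : 'rV[R]_n => y 0 i - a 0 i).
  by apply/funext => y; rewrite pder_barrier.
have ds := is_derive_dotp nu a x (delta_mx 0 j).
have dc := is_derive_coord x (delta_mx 0 j) a i.
apply: (is_derive_eq (is_deriveB (is_deriveD (is_derive_cst (nu 0 i) x _)
  (is_deriveZ (2 * K * nu 0 i) ds)) (is_deriveZ 2 dc))).
rewrite add0r mxE eqxx /=; congr (_ - _); congr (_ * _).
rewrite /dotp (bigD1 j)//= big1 => [|k kj]; last by rewrite mxE eqxx (negPf kj) mulr0.
by rewrite mxE !eqxx mulr1 addr0.
Qed.

Lemma coord_cvg x i : (y : 'rV[R]_n) 0 i @[y --> x] --> x 0 i.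
Proof. exact: coord_continuous. Qed.

Lemma dotp_cvg nu a x : dotp nu (y - a) @[y --> x] --> dotp nu (x - a).
Proof.
rewrite /dotp; move: (nbhs x) (nbhs_filter x) (coord_cvg x) => F FF cc.
apply: cvg_sumR => i; apply: cvgM; first exact: cvg_cst.
under eq_cvg do rewrite !mxE; rewrite !mxE.
by apply: cvgB; [exact: cc|exact: cvg_cst].
Qed.

Lemma sqdist_cvg a x : sqdist y a @[y --> x] --> sqdist x a.
Proof.
rewrite /sqdist; move: (nbhs x) (nbhs_filter x) (coord_cvg x) => F FF cc.
apply: cvg_sumR => i; apply: cvgM; (apply: cvgB; [exact: cc|exact: cvg_cst]).
Qed.

Lemma barrier_cvg K a nu x : barrier K a nu y @[y --> x] --> barrier K a nu x.
Proof.
rewrite /barrier.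
move: (nbhs x) (nbhs_filter x) (dotp_cvg nu a x) (sqdist_cvg a x) => F FF cd cs.
apply: cvgB => //; apply: cvgD => //; apply: cvgM; first exact: cvg_cst.
by apply: cvgM.
Qed.

Lemma pder_barrier_cvg K a nu i x :
  pder i (barrier K a nu) y @[y --> x] --> pder i (barrier K a nu) x.
Proof.
have -> : pder i (barrier K a nu) = fun x =>
    nu 0 i + 2 * K * nu 0 i * dotp nu (x - a) - 2 * (x 0 i - a 0 i).
  by apply/funext => y; rewrite pder_barrier.
move: (nbhs x) (nbhs_filter x) (dotp_cvg nu a x) (coord_cvg x) => F FF cd cc.
apply: cvgB.
  by apply: cvgD; [exact: cvg_cst|apply: cvgM => //; exact: cvg_cst].
apply: cvgM; first exact: cvg_cst.
by apply: cvgB; [exact: cc|exact: cvg_cst].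
Qed.

Lemma Ck_on_barrier K a nu (U : set 'rV[R]_n) : Ck_on 2 U (barrier K a nu).
Proof.
split=> [x _|i]; first exact: barrier_cvg.
split=> [x _|]; first by have [] := is_derive_barrier K a nu x (delta_mx 0 i).
split=> [x _|j].
  exact: pder_barrier_cvg.
split=> [x _|]; first by have [] := pder2_barrier K a nu i j x.
split=> // x _; have -> : pder j (pder i (barrier K a nu)) =
    cst (2 * K * nu 0 i * nu 0 j - 2 * (i == j)%:R).
  by apply/funext => y; rewrite /pder; have [_ ->] := pder2_barrier K a nu i j y.
exact: cst_continuous.
Qed.

End Barrier.

(** * Balls touching a level set *)

Section Hopf.
Context {R : realType} {n : nat}.
Implicit Types (x y a : 'rV[R]_n) (r : R) (U : set 'rV[R]_n).

Definition cube a r : set 'rV[R]_n := [set x | forall i, `|x 0 i - a 0 i| <= r].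

Lemma cube_compact a r : compact (cube a r).
Proof.
have -> : cube a r = [set x | forall i, `[a 0 i - r, a 0 i + r]%classic (x ord0 i)].
  apply/seteqP; split=> x /= cx i; have := cx i; rewrite ?in_itv/= ler_distl//.
apply: (@rV_compact R n (fun i => `[a 0 i - r, a 0 i + r]%classic)) => i.
exact: segment_compact.
Qed.

Lemma nbhs_cube a (P : set 'rV[R]_n) : nbhs a P ->
  exists2 r, 0 < r & cube a r `<=` P.
Proof.
move=> /nbhs_ballP[e /= e0 eP]; exists (e / 2); first by rewrite divr_gt0.
move=> x cx; apply: eP; split=> // i j; rewrite ord1 /ball/= distrC.
by rewrite (le_lt_trans (cx j))//; lra.
Qed.

Lemma coord_sqdist x a i : (x 0 i - a 0 i) ^+ 2 <= sqdist x a.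
Proof.
rewrite /sqdist (bigD1 i)//= lerDl sumr_ge0// => j _; exact: sqr_ge0.
Qed.

Lemma sqdist_cube x a r : 0 <= r -> sqdist x a <= r ^+ 2 -> cube a r x.
Proof.
move=> r0 xa i; rewrite -ler_sqr ?nnegrE// real_normK ?num_real//.
exact: le_trans (coord_sqdist x a i) xa.
Qed.

Lemma sqdistC x a : sqdist x a = sqdist a x.
Proof. by apply: eq_bigr => i _; rewrite -sqrrN opprB. Qed.

Lemma sqdistxx x : sqdist x x = 0.
Proof. by rewrite /sqdist big1// => i _; rewrite subrr expr0n. Qed.

(* The ball around y through x1 is the largest one that avoids the level set
   {w = m}. *)
Lemma interior_ball U (w : 'rV[R]_n -> R) (m : R) x0 :
  open U -> (forall x, U x -> {for x, continuous w}) ->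
  (forall x, U x -> w x <= m) -> U x0 -> w x0 = m ->
  ~ (\forall x \near x0, w x = m) ->
  exists y x1, [/\ U x1, w x1 = m, y != x1 &
    \forall x \near x1, sqdist x y < sqdist x1 y -> w x < m].
Proof.
move=> oU cw wm Ux0 wx0 notnear.
have [r r0 rU] := nbhs_cube x0 U (open_nbhs_nbhs (conj oU Ux0)).
have r20 : 0 < r / 2 by rewrite divr_gt0.
(* Half the radius suffices: [x0] is itself in the level set, so the point [x1] of [E] nearest to
   [y] lies within [r / 2] of [y], and so do its neighbors. They are then in [cube x0 r], and
   minimality over [E] is local minimality over the whole level set. *)
have [y yx0 wy] : exists2 y, sqdist y x0 < (r / 2) ^+ 2 & w y <> m.
  apply: contrapT => H; apply: notnear.
  have : \forall y \near x0, sqdist y x0 < (r / 2) ^+ 2.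
    apply: (cvgr_lt _ (sqdist_cvg x0 x0)).
    by rewrite sqdistxx exprn_gt0.
  by apply: filterS => y yx; apply: contrapT => wy; apply: H; exists y.
pose E := cube x0 r `&` [set x | w x = m].
(* [w] is continuous only on [U], so a limit point is first placed in the cube; [w < m] there would
   persist nearby. *)
have Ecl : closed E.
  move=> x Ex.
  have cx : cube x0 r x.
    apply: (compact_closed (@norm_hausdorff _ _) (cube_compact x0 r)).
    by move=> B /Ex[z [[cz _] Bz]]; exists z.
  split=> //; apply: contrapT => /eqP wxm.
  have wxlt : w x < m by rewrite lt_neqAle wxm wm//; exact: rU.
  have : nbhs x [set z | w z < m] by exact: (cvgr_lt _ (cw x (rU _ cx)) _ wxlt).
  by move=> /Ex[z [[_ /= ->]]]; rewrite ltxx.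
have Eco : compact E.
  by apply: subclosed_compact Ecl (cube_compact x0 r) _ => x [].
have Ex0 : E x0 by split=> //; apply: sqdist_cube (ltW r0) _; rewrite sqdistxx sqr_ge0.
have cs : {within E, continuous (sqdist^~ y)}.
  by apply: continuous_subspaceT => x; exact: sqdist_cvg.
have [|x1 /set_mem[cx1 wx1] x1min] := EVT_min_rV _ Eco cs; first by exists x0.
have x1y : sqdist x1 y < (r / 2) ^+ 2.
  by rewrite (le_lt_trans (x1min x0 (mem_set Ex0)))// sqdistC.
have near1 : \forall x \near x1, cube x0 r x.
  have : \forall x \near x1, sqdist x y < (r / 2) ^+ 2.
    exact: (cvgr_lt _ (sqdist_cvg y x1) _ x1y).
  apply: filterS => x xy i.
  have /(_ i) h1 := sqdist_cube _ _ _ (ltW r20) (ltW xy).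
  have /(_ i) h2 := sqdist_cube _ _ _ (ltW r20) (ltW yx0).
  rewrite -(subrKA (y 0 i)) (le_trans (ler_normD _ _))//.
  by rewrite [r in _ <= r](splitr r) lerD.
exists y, x1; split=> //; first exact: rU.
  by apply/eqP => yx1; apply: wy; rewrite yx1.
apply: filterS near1 => x cx xlt; rewrite lt_neqAle wm ?andbT; last exact: rU.
apply/eqP => wx; have := x1min x (mem_set (conj cx wx)).
by rewrite leNgt xlt.
Qed.

End Hopf.

(** * The strong maximum principle in a chart *)

Section StrongMax.
Context {R : realType} {n : nat}.
Implicit Types (x y a nu : 'rV[R]_n) (r : R) (U : set 'rV[R]_n).

Lemma barrier_center (K : R) a nu : barrier K a nu a = 0.
Proof.
rewrite /barrier sqdistxx subrr /dotp big1 => [|i _]; last by rewrite mxE mulr0.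
by rewrite expr0n mulr0; ring.
Qed.

(** At [a] the gradient of the barrier is [nu] whatever [K] is, so [K] enters only through the
    second derivatives. *)
Lemma laplacian_barrier_center (G : 'rV[R]_n -> 'M[R]_n) (K : R) a nu :
  laplacian G (barrier K a nu) a = laplacian G (barrier 0 a nu) a +
    2 * K * (nu *m invmx (G a) *m nu^T) 0 0.
Proof.
have -> : (nu *m invmx (G a) *m nu^T) 0 0 =
    \sum_i \sum_j invmx (G a) i j * (nu 0 i * nu 0 j).
  rewrite mxE exchange_big; apply: eq_bigr => j _; rewrite !mxE mulr_suml.
  by apply: eq_bigr => i _; ring.
rewrite mulr_sumr -big_split; apply: eq_bigr => i _ /=.
rewrite mulr_sumr -big_split; apply: eq_bigr => j _ /=.
have d0 : dotp nu (a - a) = 0.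
  by rewrite subrr /dotp big1// => k _; rewrite mxE mulr0.
have p1 K' : \sum_k christoffel G k i j a * pder k (barrier K' a nu) a =
    \sum_k christoffel G k i j a * nu 0 k.
  by apply: eq_bigr => k _; rewrite pder_barrier d0 subrr; ring.
have p2 K' : pder i (pder j (barrier K' a nu)) a =
    2 * K' * nu 0 j * nu 0 i - 2 * (j == i)%:R.
  by have [] := pder2_barrier K' a nu j i a.
by rewrite !mxE !p1 !p2; ring.
Qed.

(** Let s = <y - a, x - a> and d = |x - a|^2. A nonnegative barrier means 0 < d <= s (1 + K s). As
    |K s| < 1/2, this forces s > 0 and d <= 3s/2 < 2s, while |x - y|^2 = |a - y|^2 - 2s + d. *)
Lemma sqdist_barrier (K : R) a y x : 0 <= K ->
  `|K * dotp (y - a) (x - a)| < 2^-1 -> 0 <= barrier K a (y - a) x ->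
  0 < sqdist x a -> sqdist x y < sqdist a y.
Proof.
move=> K0 Ks h0 d0.
have -> : sqdist x y = sqdist a y - 2 * dotp (y - a) (x - a) + sqdist x a.
  rewrite /sqdist /dotp mulr_sumr -sumrB -big_split; apply: eq_bigr => i _ /=.
  by rewrite !mxE; ring.
rewrite /barrier in h0; set s := dotp _ _ in Ks h0 *.
set d := sqdist x a in h0 d0 *; set q := sqdist a y.
move: Ks; rewrite ltr_norml => /andP[Ks1 Ks2].
have s0 : 0 < s by nra.
have : K * s ^+ 2 <= 2^-1 * s by rewrite expr2 mulrA ler_wpM2r// ltW.
lra.
Qed.

Lemma norm_dotp_cvg (K : R) a nu : `|K * dotp nu (x - a)| @[x --> a] --> (0 : R).
Proof.
have := dotp_cvg nu a a.
have -> : dotp nu (a - a) = 0.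
  by rewrite /dotp big1// => k _; rewrite !mxE subrr mulr0.
move: (nbhs a) (nbhs_filter a) => F FF cd.
rewrite -[X in _ --> X](@normr0 R R) -(mulr0 K); apply: cvg_norm; apply: cvgM => //.
exact: cvg_cst.
Qed.

Lemma closed_ge_fun (c : R) (f : 'rV[R]_n -> R) : continuous f ->
  closed [set x | c <= f x].
Proof. by move=> /continuous_closedP/(_ _ (@closed_ge _ c)). Qed.

Lemma strong_max_principle_near (G : 'rV[R]_n -> 'M[R]_n) U w (m : R) x0 :
  open U -> (forall x, U x -> (G x)^T = G x) -> (forall x, U x -> posdef (G x)) ->
  (forall i j, Ck_on 1 U (fun x => G x i j)) -> Ck_on 2 U w ->
  (forall x, U x -> 0 <= laplacian G w x) -> (forall x, U x -> w x <= m) ->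
  U x0 -> w x0 = m -> \forall x \near x0, w x = m.
Proof.
move=> oU Gsym Gpos CG Cw lapw wm Ux0 wx0; apply: contrapT => notnear.
have cw x : U x -> {for x, continuous w} by exact: Ck_on_cont Cw.
have [y [a [Ua wa ya ball]]] := interior_ball U w m x0 oU cw wm Ux0 wx0 notnear.
pose nu := y - a.
have nu0 : nu != 0 by rewrite subr_eq0.
pose A := (nu *m invmx (G a) *m nu^T) 0 0.
have A0 : 0 < A by apply: posdef_invmx; [exact: Gsym|exact: Gpos|].
pose B := laplacian G (barrier 0 a nu) a.
(* Chosen so that the Laplacian of the barrier at [a] is [B + 1 + |B|], which is at least 1. *)
pose K := (1 + `|B|) / (2 * A).
have K0 : 0 <= K by rewrite divr_ge0// ?addr_ge0// mulr_ge0// ltW.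
pose h := barrier K a nu.
have lapa : 0 < laplacian G h a.
  rewrite laplacian_barrier_center -/B -/A.
  have -> : 2 * K * A = 1 + `|B| by rewrite /K; field; rewrite gt_eqF.
  have := ler_norm (- B); rewrite normrN; lra.
have Ch : Ck_on 2 U h by exact: Ck_on_barrier.
have ch x : h z @[z --> x] --> h x by exact: barrier_cvg.
have h_a : h a = 0 by exact: barrier_center.
have Gu x : U x -> G x \in unitmx by move=> /Gpos; exact: posdef_unitmx.
have [r r0 rP] : exists2 r, 0 < r & cube a r `<=` [set x | [/\ U x,
    sqdist x y < sqdist a y -> w x < m, 0 < laplacian G h x
    & `|K * dotp nu (x - a)| < 2^-1]].
  apply: nbhs_cube.
  have n1 : \forall x \near a, U x by exact: open_nbhs_nbhs.
  have n3 : \forall x \near a, 0 < laplacian G h x.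
    exact: (cvgr_gt _ (laplacian_cvg G U oU CG Gu h a Ch Ua)).
  have n4 : \forall x \near a, `|K * dotp nu (x - a)| < 2^-1.
    apply: (cvgr_lt _ (norm_dotp_cvg K a nu)); first by rewrite invr_gt0.
  by near=> x; split; near: x.
pose D := cube a r.
have Dco : compact D by exact: cube_compact.
have Da : D a by move=> i; rewrite subrr normr0 ltW.
have DU x : D x -> U x by move=> /rP[].
have Dlt x : D x -> 0 <= h x -> 0 < sqdist x a -> w x < m.
  by move=> /rP[_ + _ Ks] hx xa; apply; exact: sqdist_barrier Ks hx xa.
(* On [S] the touching ball gives [w < m], and compactness leaves a gap that absorbs a small
   multiple of [h]. What remains of the cube is the open round ball, where a maximum is interior,
   and the points with [h < 0], where [w + e h < m]. *)
pose S := D `&` ([set x | r ^+ 2 <= sqdist x a] `&` [set x | 0 <= h x]).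
have Sco : compact S.
  apply: compact_closedI => //; apply: closedI; apply: closed_ge_fun => // x.
  exact: sqdist_cvg.
have [e e0 eP] : exists2 e, 0 < e & forall x, S x -> 1 * w x + e * h x < m.
  have [S0|/set0P Sn] := eqVneq S set0; first by exists 1 => // x; rewrite S0.
  have [||b /set_mem Db hmax] := @EVT_max_rV R n h D _ Dco; first by exists a.
    exact: continuous_subspaceT.
  have [|c /set_mem[Dc [cr hc]] wmax] := EVT_max_rV Sn Sco (f := w).
    apply: continuous_in_subspaceT => x /set_mem[Dx _]; exact/cw/DU.
  have wc : w c < m by apply: Dlt => //; rewrite (lt_le_trans _ cr)// exprn_gt0.
  have hb0 : 0 <= h b by rewrite -h_a hmax//; exact: mem_set.
  (* With [w c] the maximum of [w] on [S] and [h b] that of [h] on [D], the sum is at most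
     [w c + e * h b], that is [m - e]. *)
  pose e := (m - w c) / (h b + 1).
  have hb1 : 0 < h b + 1 by lra.
  have e0 : 0 < e by rewrite divr_gt0// subr_gt0.
  exists e => // x Sx; have := wmax x (mem_set Sx).
  have hxb : h x <= h b by case: (Sx) => Dx _; exact: hmax (mem_set Dx).
  have : e * h x <= e * h b by rewrite ler_wpM2l// ltW.
  have : e * (h b + 1) = m - w c by rewrite /e divfK// gt_eqF.
  rewrite mulrDr mulr1 mul1r; lra.
(* v has a maximum over the cube at an interior point, where its Laplacian is
   both nonpositive and positive. *)
pose v := fun x => 1 * w x + e * h x.
have Cv : Ck_on 2 U v by exact: Ck_on_lin.
have [||z /set_mem Dz vmax] := @EVT_max_rV R n v D _ Dco; first by exists a.
  apply: continuous_in_subspaceT => x /set_mem Dx.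
  exact: (Ck_on_cont _ _ _ _ Cv (DU _ Dx)).
have vz : m <= v z.
  by rewrite (le_trans _ (vmax a (mem_set Da)))// /v h_a wa mulr0 addr0 mul1r.
have hz : 0 <= h z.
  rewrite leNgt; apply/negP => hz.
  have : e * h z < 0 by rewrite pmulr_rlt0.
  have := wm z (DU z Dz); rewrite /v in vz; lra.
have zr : sqdist z a < r ^+ 2.
  rewrite ltNge; apply/negP => zr; have := eP z (conj Dz (conj zr hz)).
  by rewrite ltNge vz.
have : laplacian G v z <= 0.
  apply: (laplacian_le0_max G U oU v z (Gsym _ (DU _ Dz)) (Gpos _ (DU _ Dz)) Cv) => //.
    exact: DU.
  have : \forall x \near z, sqdist x a < r ^+ 2 by exact: (cvgr_lt _ (sqdist_cvg a z)).
  apply: filterS => x xr; apply/vmax/mem_set.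
  by apply: sqdist_cube; exact: ltW.
rewrite (laplacian_lin G U oU 1 e w h z Cw Ch (DU z Dz)).
have := lapw z (DU z Dz); have [_ _ lz _] := rP z Dz.
have : 0 < e * laplacian G h z by rewrite mulr_gt0.
move: (laplacian G w z) (e * laplacian G h z) => p q; lra.
Unshelve. all: by end_near. Qed.

End StrongMax.

(** * From charts to the manifold *)

Section Manifold.
Context {R : realType} {n : nat} {M : topologicalType} {A : smooth_atlas R n M}.
Variables (g : riemannian_metric A) (u : M -> R).
Hypothesis u_smooth : smooth_fun A u.

Lemma smooth_fun_continuous : continuous u.
Proof.
move=> p; have [a ap] := dom_cover A p.
have uc : {for p, continuous ((u \o param a) \o chart a)}.
  apply: continuous_comp; first exact: chart_continuous.
  by apply: (Ck_on_cont 0 (img a)); [exact: u_smooth|exists p].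
have E : \forall q \near p, ((u \o param a) \o chart a) q = u q.
  have : \forall q \near p, dom a q by apply: open_nbhs_nbhs; split=> //; exact: dom_open.
  by apply: filterS => q aq /=; rewrite chartK.
rewrite /continuous_at -[X in _ --> X](nbhs_singleton E).
by apply: cvg_trans uc; apply: (near_eq_cvg E).
Qed.

Lemma laplace_beltrami_le0_max (a : idx A) p : dom a p ->
  (forall q, u q <= u p) -> laplace_beltrami_in g a u p <= 0.
Proof.
move=> ap umax; have ia : img a (chart a p) by exists p.
apply: (laplacian_le0_max (gmat g a) (img a) (@img_open _ _ _ A a)
  (u \o param a) (chart a p) (gmat_sym g ia) _ (u_smooth a 2) ia).
  by move=> v; exact: gmat_pos.
by near=> y; rewrite /comp chartK.
Unshelve. all: by end_near. Qed.

Lemma laplace_beltrami_ge0_min (a : idx A) p : dom a p ->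
  (forall q, u p <= u q) -> 0 <= laplace_beltrami_in g a u p.
Proof.
move=> ap umin; have ia : img a (chart a p) by exists p.
have Cu : Ck_on 2 (img a) (u \o param a) by exact: u_smooth.
have oU := @img_open _ _ _ A a.
(* This is the opposite of [u] in the chart, written in the form treated by [Ck_on_lin] and
   [laplacian_lin]. *)
pose v y := -1 * (u \o param a) y + 0 * (u \o param a) y.
have Cv : Ck_on 2 (img a) v := Ck_on_lin 2 (img a) (-1) 0 _ _ oU Cu Cu.
have lapv : laplacian (gmat g a) v (chart a p) = - laplace_beltrami_in g a u p.
  by rewrite (laplacian_lin _ (img a) oU _ _ _ _ _ Cu Cu ia) mul0r addr0 mulN1r.
rewrite -oppr_le0 -lapv.
apply: (laplacian_le0_max (gmat g a) (img a) oU v (chart a p)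
  (gmat_sym g ia) _ Cv ia); first by move=> w; exact: gmat_pos.
by near=> y; rewrite /v !mul0r !addr0 !mulN1r lerN2 /comp chartK.
Unshelve. all: by end_near. Qed.

(** The set where [u] attains its maximum is open by the local principle in a chart, closed by
    continuity, and contains [p]. *)
Lemma strong_max_principle p : connected [set: M] ->
  (forall (a : idx A) q, dom a q -> 0 <= laplace_beltrami_in g a u q) ->
  (forall q, u q <= u p) -> forall q, u q = u p.
Proof.
move=> cM lapu umax; pose E := [set q | u q = u p].
have Eop : open E.
  rewrite openE => q /= uq; have [a aq] := dom_cover A q.
  have iq : img a (chart a q) by exists q.
  have near_img : \forall y \near chart a q, (u \o param a) y = u p.
    apply: (strong_max_principle_near (gmat g a) (img a) (u \o param a) (u p)
      (chart a q) (@img_open _ _ _ A a) (@gmat_sym _ _ _ _ g a)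
      (fun x ix v => @gmat_pos _ _ _ _ g a x v ix)
      (fun i j => gmat_smooth g a i j 1) (u_smooth a 2) _ _ iq).
    - by move=> _ [z az <-]; exact: lapu.
    - by move=> x _; exact: umax.
    - by rewrite /comp chartK.
  have := chart_continuous aq near_img; rewrite nbhs_simpl /=.
  have : \forall z \near q, dom a z.
    by apply: open_nbhs_nbhs; split=> //; exact: dom_open.
  by apply: filterS2 => z az /=; rewrite chartK.
have Ecl : closed E.
  have -> : E = u @^-1` [set u p] by [].
  move/continuous_closedP : smooth_fun_continuous; apply; exact: closed_eq.
have ET : E = [set: M].
  by apply: cM; [exists p|exists E; rewrite ?setTI|exists E; rewrite ?setTI].
by move=> q; have : E q by rewrite ET.
Qed.

End Manifold.

(** * The nonlinearity and the conclusion *)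

(** The derivative of s^(-beta) f(s) is -s^(-beta-1) (beta f(s) - s f'(s)). *)
Lemma nonincr_powR_mul {R : realType} (f : R -> R) (beta a b : R) :
  0 < a -> (forall s : R, 0 < s -> derivable f s 1) ->
  (forall s : R, 0 < s -> 0 <= beta * f s - s * derive1 f s) ->
  forall s t, a <= s -> s <= t -> t <= b ->
    t `^ (- beta) * f t <= s `^ (- beta) * f s.
Proof.
move=> a0 df fb.
have dg (s : R) : 0 < s -> is_derive s 1 ((@powR R ^~ (- beta)) * f)
    (- (s `^ (- beta - 1) * (beta * f s - s * derive1 f s))).
  move=> s0; have sI : s \in `]0, +oo[%R by rewrite in_itv/= s0.
  have d1 : is_derive s 1 (@powR R ^~ (- beta)) (- beta * s `^ (- beta - 1)).
    rewrite -powR_derive1// derive1E; apply: derivableP; exact: derivable_powR.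
  have d2 : is_derive s 1 f (derive1 f s).
    by rewrite derive1E; apply: derivableP; exact: df.
  apply: is_derive_eq.
  have -> : s `^ (- beta) = s `^ (- beta - 1) * s.
    rewrite -{3}[s]powRr1 ?ltW// -powRD ?subrK//.
    by apply/implyP => _; rewrite gt_eqF.
  by rewrite /GRing.scale /=; ring.
have pos s : a <= s -> 0 < s by exact: lt_le_trans.
apply: (ler0_derive1_nincr (f := (@powR R ^~ (- beta)) * f)).
- by move=> s; rewrite in_itv/= => /andP[/ltW/pos/dg[]].
- move=> s; rewrite in_itv/= => /andP[/ltW/pos s0 _].
  rewrite derive1E; have [_ ->] := dg s s0.
  by rewrite oppr_le0 mulr_ge0 ?powR_ge0// fb.
- apply: derivable_within_continuous => s; rewrite in_itv/= => /andP[/pos/dg[]].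
  by [].
Qed.

Theorem theorem1p4 (R : realType) (n : nat) (hn : (2 < n)%N)
  (M : topologicalType)
  (M_hausdorff : hausdorff_space M)
  (M_second_countable : @second_countable M)
  (M_compact : compact [set: M])
  (M_connected : connected [set: M])
  (A : smooth_atlas R n M)
  (g : riemannian_metric A)
  (g_ricci : nonneg_ricci g)
  (f : R -> R)
  (f_continuous : {within [set s : R | 0 <= s], continuous f})
  (f_derivable : forall s : R, 0 < s -> derivable f s 1)
  (f_C1 : forall s : R, 0 < s -> {for s, continuous (derive1 f)})
  (f_zero : exists2 s : R, 0 <= s & f s = 0)
  (u : M -> R)
  (u_smooth : smooth_fun A u)
  (u_pos : forall p : M, 0 < u p)
  (u_sol : solves g f u) :
  ((exists beta : R,
      [/\ 0 < beta,
          beta < (n%:R + 2) / (n%:R - 2)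
        & forall s : R, 0 < s -> 0 <= beta * f s - s * derive1 f s]) ->
   exists c : R, forall p : M, u p = c)
  /\
  ((forall s t : R, 0 < s -> s < t ->
      t `^ (- ((n%:R + 2) / (n%:R - 2))) * f t
      < s `^ (- ((n%:R + 2) / (n%:R - 2))) * f s) ->
   exists c : R, forall p : M, u p = c).
Proof.
(* The hypotheses allow an empty [M], on which [u] has no extremum points. *)
have [M0|M0] := pselect ([set: M] !=set0); last first.
  by split=> _; exists 0 => p; exfalso; apply: M0; exists p.
have cu : {within [set: M], continuous u}.
  by apply: continuous_subspaceT; exact: smooth_fun_continuous u_smooth.
have [pM _ umax] := compact_EVT_max M0 M_compact cu.
have [pm _ umin] := compact_EVT_min M0 M_compact cu.
have {}umax q : u q <= u pM by exact/umax/mem_set.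
have {}umin q : u pm <= u q by exact/umin/mem_set.
have fM : 0 <= f (u pM).
  have [a ap] := dom_cover A pM.
  have := laplace_beltrami_le0_max g u u_smooth a pM ap umax.
  by have := u_sol a pM ap; lra.
have fm : f (u pm) <= 0.
  have [a ap] := dom_cover A pm.
  have := laplace_beltrami_ge0_min g u u_smooth a pm ap umin.
  by have := u_sol a pm ap; lra.
have pw (s c : R) : 0 < s -> 0 < s `^ c by exact: powR_gt0.
split=> [[beta [_ _ fb]]|fdecr]; last first.
  exists (u pM) => p; apply/eqP; rewrite eq_le umax /= (le_trans _ (umin p))//.
  (* If [u pm < u pM], strict decrease puts the weighted value at [u pM] below that at [u pm],
     against the signs of [fM] and [fm]. *)
  rewrite leNgt; apply/negP => /(fdecr _ _ (u_pos pm)).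
  rewrite ltNge => /negP; apply.
  by rewrite (@le_trans _ _ 0)// ?pmulr_rle0 ?pmulr_rge0 ?pw.
have gdecr := nonincr_powR_mul f beta (u pm) (u pM) (u_pos pm)
  f_derivable fb.
have f0 q : f (u q) = 0.
  have hi := gdecr _ _ (umin q) (umax q) (lexx _).
  have lo := gdecr _ _ (lexx _) (umin q) (umax q).
  have uq := pw (u q) (- beta) (u_pos q).
  apply/eqP; rewrite eq_le -(pmulr_rle0 _ uq) -(pmulr_rge0 _ uq).
  by rewrite (le_trans lo) ?(le_trans _ hi) ?pmulr_rle0 ?pmulr_rge0 ?pw.
exists (u pM); apply: (strong_max_principle g u u_smooth) => // a q aq.
by have := u_sol a q aq; rewrite f0 addr0 => ->.
Qed.
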